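(* Let $G$ be a finite group of one-to-one transformations of the experimental region $\mathcal{X}$ onto itself, and let $\Phi$ be a criterion function on the designs on $\mathcal{X}$. If $\Phi$ is invariant with respect to $G$ and convex, then there exists a design $\xi^*$ which is invariant with respect to $G$ and which is $\Phi$-optimal over all designs on $\mathcal{X}$.
   Context: A design $\xi$ on $\mathcal{X}$ is a finitely supported probability measure on $\mathcal{X}$, given by distinct support points $\mathbf{x}_1,\dots,\mathbf{x}_m$ and weights $w_i>0$ with $\sum_iw_i=1$; convex combinations of designs are taken as measures. For $g\in G$, the image $\xi^g$ is the design with support points $g(\mathbf{x}_i)$ and weights $w_i$. A design is invariant with respect to $G$ if $\xi^g=\xi$ for all $g\in G$. A criterion function is a function from designs on $\mathcal{X}$ to $\mathbb{R}\cup\{\infty\}$, to be minimized; it is convex if $\Phi(\alpha\xi_1+(1-\alpha)\xi_2)\le\alpha\Phi(\xi_1)+(1-\alpha)\Phi(\xi_2)$ for all designs $\xi_1,\xi_2$ and $\alpha\in[0,1]$, and invariant with respect to $G$ if $\Phi(\xi^g)=\Phi(\xi)$ for all $g\in G$ and all designs $\xi$. A design $\xi^*$ is $\Phi$-optimal if it minimizes $\Phi$, i.e. $\Phi(\xi^* )=\min_\xi\Phi(\xi)$, the minimum being over all designs on $\mathcal{X}$.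
   Formalization: It is additionally assumed that some Φ-optimal design exists (the minimum of Φ over all designs is attained); without this the claim fails, e.g. for X the natural numbers, G trivial and Φ(ξ) the sum of w_i/(1+x_i). *)

(* Defs.v *)
From HB Require Import structures.
From mathcomp Require Import all_boot all_order all_algebra finmap.
From mathcomp Require Import all_classical all_reals interval_inference.
Set Implicit Arguments.
Unset Strict Implicit.
Unset Printing Implicit Defensive.
Import Order.TTheory GRing.Theory Num.Theory.
Local Open Scope ring_scope.

Section Designs.
Variables (R : realType) (X : choiceType).
Implicit Types (f : {fsfun X -> R with 0}) (g : X -> X).

(* [finsupp f] is the set of support points: [f] vanishes exactly outside it. *)
Definition is_design f : bool :=
  all (fun x => 0 < f x) (finsupp f) && (\sum_(x <- finsupp f) f x == 1).

Record design := Design {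
  weight :> {fsfun X -> R with 0};
  weightP : is_design weight }.
HB.instance Definition _ := [isSub for weight].
HB.instance Definition _ := [Choice of design by <:].

Implicit Types xi : design.

Lemma is_design_intro f (S : {fset X}) :
  (forall x, 0 <= f x) -> (finsupp f `<=` S)%fset -> \sum_(x <- S) f x = 1 ->
  is_design f.
Proof.
move=> f0 fS f1; apply/andP; split.
  by apply/allP => x; rewrite mem_finsupp lt0r f0 andbT.
rewrite (big_fset_incl _ fS) ?f1// => x _.
exact: fsfun_dflt.
Qed.

Lemma design_ge0 xi x : 0 <= xi x.
Proof.
case: (boolP (x \in finsupp xi)) => [xS|/fsfun_dflt->//].
by have /andP[/allP/(_ _ xS)/ltW] := weightP xi.
Qed.

Lemma design_sum xi (S : {fset X}) :
  (finsupp xi `<=` S)%fset -> \sum_(x <- S) xi x = 1.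
Proof.
have /andP[_ /eqP <-] := weightP xi => xiS.
by apply/esym/(big_fset_incl _ xiS) => x _; exact: fsfun_dflt.
Qed.

(* Defined for an arbitrary map [g], as the push-forward of [xi]: weights of
   support points with the same image add up, which for an injective [g] only
   moves the weight of [x] to [g x]. *)
Definition image_weight g xi : {fsfun X -> R with 0} :=
  [fsfun y in [fset g x | x in finsupp xi]%fset =>
     \sum_(x <- finsupp xi | g x == y) xi x].

Lemma image_weightE g xi y :
  image_weight g xi y = \sum_(x <- finsupp xi | g x == y) xi x.
Proof.
rewrite fsfun_fun; case: ifPn => // yS; rewrite big_seq_cond big1// => x.
by case/andP => xS /eqP gxy; case/negP: yS; rewrite -gxy in_imfset.
Qed.

Lemma image_weightP g xi : is_design (image_weight g xi).
Proof.
apply: (@is_design_intro _ [fset g x | x in finsupp xi]%fset).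
- move=> y; rewrite image_weightE; apply: sumr_ge0 => x _; exact: design_ge0.
- by apply: finsupp_sub.
under eq_bigr do rewrite image_weightE.
by rewrite -(partition_big_imfset _ g) design_sum.
Qed.

Definition design_image g xi : design := Design (image_weightP g xi).

Definition mix_weight (t : {i01 R}) xi1 xi2 : {fsfun X -> R with 0} :=
  [fsfun x in (finsupp xi1 `|` finsupp xi2)%fset =>
     t%:num * xi1 x + (1 - t%:num) * xi2 x].

Lemma mix_weightE t xi1 xi2 x :
  mix_weight t xi1 xi2 x = t%:num * xi1 x + (1 - t%:num) * xi2 x.
Proof.
rewrite fsfun_fun in_fsetU; case: ifPn => //.
by rewrite negb_or => /andP[/fsfun_dflt-> /fsfun_dflt->]; rewrite !mulr0 addr0.
Qed.

Lemma mix_weightP t xi1 xi2 : is_design (mix_weight t xi1 xi2).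
Proof.
apply: (@is_design_intro _ (finsupp xi1 `|` finsupp xi2)%fset).
- move=> x; rewrite mix_weightE.
  by rewrite addr_ge0// mulr_ge0 ?design_ge0// subr_ge0.
- by apply: finsupp_sub.
under eq_bigr do rewrite mix_weightE.
rewrite big_split -!mulr_sumr !design_sum ?fsubsetUl ?fsubsetUr//=.
by rewrite !mulr1 addrC subrK.
Qed.

Definition design_mix t xi1 xi2 : design := Design (mix_weightP t xi1 xi2).

Definition transformation_group (G : set (X -> X)) : Prop :=
  [/\ forall g, G g -> bijective g,
      G id,
      forall g h, G g -> G h -> G (g \o h) &
      forall g h, G g -> cancel g h -> cancel h g -> G h].

Definition invariant_design (G : set (X -> X)) xi : Prop :=
  forall g, G g -> design_image g xi = xi.

Definition criterion (Phi : design -> \bar R) : Prop :=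
  forall xi, Phi xi != -oo%E.

Definition invariant_criterion (G : set (X -> X)) (Phi : design -> \bar R) :
  Prop := forall g xi, G g -> Phi (design_image g xi) = Phi xi.

(* In [\bar R], [0 * +oo = 0], so the inequality is trivial at [t = 0, 1]. *)
Definition convex_criterion (Phi : design -> \bar R) : Prop :=
  forall (t : {i01 R}) xi1 xi2,
    (Phi (design_mix t xi1 xi2)
       <= t%:num%:E * Phi xi1 + (1 - t%:num)%:E * Phi xi2)%E.

Definition optimal_design (Phi : design -> \bar R) xi : Prop :=
  forall xi', (Phi xi <= Phi xi')%E.

End Designs.

(* Main.v *)
(* The average of the images of an optimal design over the whole group is again
   optimal by convexity, and left translation by a group element only permutes
   the summands. *)
Require Import Defs.
From mathcomp Require Import all_boot all_order all_algebra finmap.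
From mathcomp Require Import all_classical all_reals interval_inference.
Set Implicit Arguments.
Unset Strict Implicit.
Unset Printing Implicit Defensive.
Import Order.TTheory GRing.Theory Num.Theory.
Local Open Scope ring_scope.

(** Invariance of [Phi] makes every image of an optimal [xi0] under [G] optimal. Optimal designs
    form a convex set ([optimal_design_mix]), so the uniform average of these images is optimal
    ([optimal_design_average]). Pushing it forward by [h] in [G] turns each index [g] into [h \o g],
    which only permutes [G] ([perm_comp_group]), so the average is invariant. *)

Section Averaging.
Variables (R : realType) (X : choiceType).
Implicit Types (xi : design R X) (Phi : design R X -> \bar R).

Lemma design_eqP xi1 xi2 : (forall x, xi1 x = xi2 x) -> xi1 = xi2.
Proof. by move=> e; apply/val_inj/fsfunP. Qed.

Lemma design_image_inj (h : X -> X) xi x :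
  injective h -> design_image h xi (h x) = xi x.
Proof.
move=> h_inj; rewrite image_weightE big_mkcond /=.
case: (boolP (x \in finsupp xi)) => xS.
  rewrite (bigD1_seq x) ?fset_uniq//= eqxx big1 ?addr0// => z zx.
  by rewrite (inj_eq h_inj) (negPf zx).
rewrite (fsfun_dflt xS) big_seq big1// => z zS; case: eqP => // /h_inj zx.
by rewrite zx (negPf xS) in zS.
Qed.

Lemma design_image_comp_inj (g h : X -> X) xi x :
  injective h -> design_image (h \o g) xi (h x) = design_image g xi x.
Proof.
by move=> h_inj; rewrite !image_weightE; apply: eq_bigl => z /=; rewrite inj_eq.
Qed.

Lemma optimal_design_mix Phi t xi1 xi2 :
  criterion Phi -> convex_criterion Phi ->
  optimal_design Phi xi1 -> optimal_design Phi xi2 ->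
  optimal_design Phi (design_mix t xi1 xi2).
Proof.
move=> critPhi convPhi opt1 opt2 xi; apply: le_trans (convPhi t xi1 xi2) _.
have -> : Phi xi2 = Phi xi1 by apply/le_anti; rewrite opt1 opt2.
apply: le_trans (opt1 xi); move: (critPhi xi1).
(* A minimum of [+oo] bounds everything; for a real minimum [r] the two terms add up to [r]. *)
case: (Phi xi1) => [r| |]// _; last by rewrite leey.
by rewrite -!EFinM -EFinD lee_fin -mulrDl addrC subrK mul1r.
Qed.

(** Induction reduces averages to binary mixtures: the mean of [n.+1] designs mixes the first, with
    weight [n.+1%:R^-1], and the mean of the other [n]. Repeated entries count with multiplicity. *)
Lemma optimal_design_average Phi xi0 (s : seq (design R X)) :
  criterion Phi -> convex_criterion Phi ->
  (forall xi, xi \in xi0 :: s -> optimal_design Phi xi) ->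
  exists2 xi, optimal_design Phi xi &
    forall x, (size s).+1%:R * xi x = \sum_(z <- xi0 :: s) z x.
Proof.
move=> critPhi convPhi; elim: s xi0 => [|xi1 s IHs] xi0 opt.
  exists xi0; first by apply: opt; rewrite mem_head.
  by move=> x; rewrite big_seq1 mul1r.
have [|xi opt_xi xiE] := IHs xi1.
  by move=> z zs; apply: opt; rewrite inE zs orbT.
set n := (size s).+1 in xiE *.
have n1_neq0 : n.+1%:R != 0 :> R by rewrite pnatr_eq0.
have t_ge0 : 0 <= n.+1%:R^-1 :> R by rewrite invr_ge0.
have t_le1 : n.+1%:R^-1 <= 1 :> R by rewrite invf_le1 ?ltr0n// ler1n.
exists (design_mix (Itv01 t_ge0 t_le1) xi0 xi).
  by apply: optimal_design_mix => //; apply: opt; rewrite mem_head.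
move=> x; rewrite big_cons -xiE mix_weightE /= mulrDr !mulrA mulrBr.
by rewrite divff// mul1r mulr1 -natr1 addrK.
Qed.

(** Left translation by [h] is injective since [h] is, and onto since [f] equals [h \o (k \o f)] for
    the inverse [k] of [h], which lies in [G]. *)
Lemma perm_comp_group (G : set (X -> X)) h :
  finite_set G -> transformation_group G -> G h ->
  perm_eq [seq h \o g | g <- fset_set G] (fset_set G).
Proof.
move=> finG [bijG _ compG invG] Gh; have [k hK kH] := bijG h Gh.
apply: uniq_perm; rewrite ?fset_uniq//.
  rewrite map_inj_uniq ?fset_uniq// => f g /funeqP fg.
  by apply/funeqP => x; apply: (can_inj hK); exact: fg.
move=> f; rewrite in_fset_set//; apply/mapP/idP => [[g]|].
  by rewrite in_fset_set// => /set_mem Gg ->; apply/mem_set/compG.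
move=> /set_mem Gf; exists (k \o f).
  by rewrite in_fset_set//; apply/mem_set/compG => //; exact: (invG h).
by apply/funeqP => x /=; rewrite kH.
Qed.

End Averaging.

(* The minimum of Phi over all designs is assumed to be attained. *)
Theorem theorem2 (R : realType) (X : choiceType) (G : set (X -> X))
    (Phi : design R X -> \bar R)
    (finG : finite_set G) (grpG : transformation_group G)
    (critPhi : criterion Phi)
    (minPhi : exists xi0 : design R X, optimal_design Phi xi0)
    (invPhi : invariant_criterion G Phi) (convPhi : convex_criterion Phi) :
  exists xi : design R X, invariant_design G xi /\ optimal_design Phi xi.
Proof.
have [xi0 opt0] := minPhi; have [bijG G1 _ _] := grpG.
pose orb := [seq design_image g xi0 | g <- fset_set G].
have opt_orb z : z \in orb -> optimal_design Phi z.
  case/mapP => g; rewrite in_fset_set// => /set_mem Gg -> xi.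
  by rewrite (invPhi _ _ Gg).
have [xi opt_xi [n xiE]] : exists2 xi, optimal_design Phi xi &
    exists n, forall x, n.+1%:R * xi x = \sum_(z <- orb) z x.
  (* Averaging needs a nonempty list; the identity of [G] provides an entry. *)
  have : design_image id xi0 \in orb.
    by apply: map_f; rewrite in_fset_set//; exact/mem_set.
  case: orb opt_orb => // z s opt_s _.
  have [xi opt_xi xiE] := optimal_design_average critPhi convPhi opt_s.
  by exists xi => //; exists (size s).
exists xi; split=> // h Gh; have [k hK kH] := bijG h Gh.
have h_inj := can_inj hK.
(* Invariance as constancy of the weights along orbits: reindexing the sum by [h \o g] lets [h]
   cancel on both sides. *)
have xih x : xi (h x) = xi x.
  apply: (@mulfI _ n.+1%:R); rewrite ?pnatr_eq0// !xiE !big_map.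
  rewrite -(perm_big _ (perm_comp_group finG grpG Gh)) big_map.
  by apply: eq_bigr => g _; exact: design_image_comp_inj.
by apply: design_eqP => y; rewrite -(kH y) design_image_inj.
Qed.
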